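(* Let $A\in\mathbb{R}^{n\times n}$, $B\in\mathbb{R}^{n\times p}$, $C\in\mathbb{R}^{p\times n}$, let $\sigma_1,\dots,\sigma_{m+1},\mu_1,\dots,\mu_{m+1}\in\mathbb{R}$ be such that all $\sigma_iI_n-A$ and $\mu_iI_n-A$ are invertible, and let $R_1,\dots,R_{m+1},L_1,\dots,L_{m+1}\in\mathbb{R}^{p\times s}$. Let $\mathbb{V}_{m+1}=[V_1,\dots,V_{m+1}]$ and $\mathbb{W}_{m+1}=[W_1,\dots,W_{m+1}]$ in $\mathbb{R}^{n\times(m+1)s}$ be the bi-orthonormal matrices constructed by the Block Tangential Lanczos (BTL) algorithm (described in the context, assumed to run without breakdown) from these data, and let $H_{i,j}$, $F_{i,j}\in\mathbb{R}^{s\times s}$ be the coefficient matrices it produces. Let $\mathbb{G}_{m+1}$ and $\mathbb{Q}_{m+1}$ be the $(m+1)s\times(m+1)s$ block upper triangular matrices whose $(j+1)$-th block columns ($j=0,\dots,m$) are $$\widetilde{\mathbb{H}}^{(j)}=\begin{bmatrix}H_{1,j}\\ \vdots\\ H_{j+1,j}\\ \mathbf{0}\end{bmatrix},\qquad \widetilde{\mathbb{F}}^{(j)}=\begin{bmatrix}F_{1,j}\\ \vdots\\ F_{j+1,j}\\ \mathbf{0}\end{bmatrix},$$ respectively, where $\mathbf{0}$ is the zero matrix of size $(m-j)s\times s$; assume $\mathbb{G}_{m+1}$ and $\mathbb{Q}_{m+1}$ are non-singular. Put $\mathbb{R}_{m+1}=[R_1,\dots,R_{m+1}]$, $\mathbb{L}_{m+1}=[L_1,\dots,L_{m+1}]$,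 $\widetilde D^{(1)}_{m+1}=\mathrm{Diag}\{\sigma_1,\dots,\sigma_{m+1}\}\otimes I_s$ and $\widetilde D^{(2)}_{m+1}=\mathrm{Diag}\{\mu_1,\dots,\mu_{m+1}\}\otimes I_s$. Then $$A\mathbb{V}_{m+1}=\left[\mathbb{V}_{m+1}\mathbb{G}_{m+1}\widetilde D^{(1)}_{m+1}-B\mathbb{R}_{m+1}\right]\mathbb{G}_{m+1}^{-1},$$ $$A^T\mathbb{W}_{m+1}=\left[\mathbb{W}_{m+1}\mathbb{Q}_{m+1}\widetilde D^{(2)}_{m+1}-C^T\mathbb{L}_{m+1}\right]\mathbb{Q}_{m+1}^{-1}.$$ Moreover, with $$\mathbb{T}_{m+1}=\left[(\sigma_1I_n-A)^{-1}BR_1,\dots,(\sigma_{m+1}I_n-A)^{-1}BR_{m+1}\right],$$ $$\mathbb{Y}_{m+1}=\left[(\mu_1I_n-A)^{-T}C^TL_1,\dots,(\mu_{m+1}I_n-A)^{-T}C^TL_{m+1}\right],$$ one has $$\mathbb{T}_{m+1}=\mathbb{V}_{m+1}\mathbb{G}_{m+1}\quad\text{and}\quad \mathbb{Y}_{m+1}=\mathbb{W}_{m+1}\mathbb{Q}_{m+1}.$$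
   Context: Here $s\le p$, and $M^{-T}$ denotes $(M^{-1})^T$. All blocks $V_i,W_i$ lie in $\mathbb{R}^{n\times s}$. ''Bi-orthonormal'' means $W_i^TV_j=I_s$ if $i=j$ and $W_i^TV_j=0$ if $i\ne j$. Block Tangential Lanczos (BTL) algorithm with inputs $A,B,C,\{\sigma_i\}_{i=1}^{m+1},\{\mu_i\}_{i=1}^{m+1},\{R_i\}_{i=1}^{m+1},\{L_i\}_{i=1}^{m+1}$: Initialization: compute factorizations $(\sigma_1I_n-A)^{-1}BR_1=V_1H_{1,0}$ and $(\mu_1I_n-A)^{-T}C^TL_1=W_1F_{1,0}$ with $V_1,W_1\in\mathbb{R}^{n\times s}$, $H_{1,0},F_{1,0}\in\mathbb{R}^{s\times s}$ and $W_1^TV_1=I_s$. For $j=1,\dots,m$: 1. Set $\widetilde V_{j+1}=(\sigma_{j+1}I_n-A)^{-1}BR_{j+1}$ and $\widetilde W_{j+1}=(\mu_{j+1}I_n-A)^{-T}C^TL_{j+1}$. 2. For $i=1,\dots,j$ successively: $H_{i,j}=W_i^T\widetilde V_{j+1}$, $F_{i,j}=V_i^T\widetilde W_{j+1}$; then update $\widetilde V_{j+1}\leftarrow\widetilde V_{j+1}-V_iH_{i,j}$, $\widetilde W_{j+1}\leftarrow\widetilde W_{j+1}-W_iF_{i,j}$. 3. Compute (thin) QR decompositions $\widetilde V_{j+1}=V_{j+1}H_{j+1,j}$, $\widetilde W_{j+1}=W_{j+1}F_{j+1,j}$. 4. Compute the singular value decomposition $W_{j+1}^TV_{j+1}=P_{j+1}D_{j+1}Q_{j+1}^T$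 (the diagonal matrix $D_{j+1}$ is assumed invertible, i.e. no breakdown). 5. Update $V_{j+1}\leftarrow V_{j+1}Q_{j+1}D_{j+1}^{-1/2}$, $W_{j+1}\leftarrow W_{j+1}P_{j+1}D_{j+1}^{-1/2}$, $H_{j+1,j}\leftarrow D_{j+1}^{1/2}Q_{j+1}^TH_{j+1,j}$, $F_{j+1,j}\leftarrow D_{j+1}^{1/2}P_{j+1}^TF_{j+1,j}$. The output is $\mathbb{V}_{m+1}=[V_1,\dots,V_{m+1}]$, $\mathbb{W}_{m+1}=[W_1,\dots,W_{m+1}]$, where $V_{j},W_j,H_{i,j},F_{i,j}$ denote the final values. *)

(* Defs.v *)
From HB Require Import structures.
From mathcomp Require Import all_boot all_order all_algebra.
From mathcomp Require Import reals.
From mathcomp Require Import mxtens.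

Set Implicit Arguments.
Unset Strict Implicit.
Unset Printing Implicit Defensive.

Import GRing.Theory Num.Theory.
Local Open Scope ring_scope.

(* Blocks are indexed from 0: V j, W j, sigma j, mu j stand for V_{j+1},
   W_{j+1}, sigma_{j+1}, mu_{j+1}, and H i j, F i j for H_{i+1,j}, F_{i+1,j}
   (whose second index already starts at 0). *)

Section Factorizations.
Variable R : realType.

(* [is_trig_mx] means lower triangular, hence the transpose. *)
Definition thin_qr n s (X Q : 'M[R]_(n, s)) (U : 'M[R]_s) : Prop :=
  [/\ Q^T *m Q = 1%:M, is_trig_mx U^T & X = Q *m U].

(* The singular values are not required to be sorted. *)
Definition svd s (M P : 'M[R]_s) (d : 'rV[R]_s) (Q : 'M[R]_s) : Prop :=
  [/\ P^T *m P = 1%:M, Q^T *m Q = 1%:M, forall k, 0 <= d 0 k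
    & M = P *m diag_mx d *m Q^T].

Definition diag_sqrt s (d : 'rV[R]_s) : 'M[R]_s := diag_mx (map_mx Num.sqrt d).

End Factorizations.

Section BlockTangentialLanczos.
Variable R : realType.
Variables n p s m : nat.
Implicit Types (V W : 'I_m.+1 -> 'M[R]_(n, s)).
Implicit Types (H F : 'I_m.+1 -> 'I_m.+1 -> 'M[R]_s).

(* Z i is the value of the working block X before the i-th update, so that
   each coefficient is computed from the partially updated block. *)
Definition orthogonalize V W (j : nat) (X : 'M[R]_(n, s))
    (h : 'I_m.+1 -> 'M[R]_s) (Y : 'M[R]_(n, s)) : Prop :=
  exists Z : nat -> 'M[R]_(n, s),
    [/\ Z 0%N = X,
        forall i : 'I_m.+1, (i < j)%N ->
          h i = (W i)^T *m Z i /\ Z i.+1 = Z i - V i *m h i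
      & Z j = Y].

(* P, d, Q is the SVD of Wq^T Vq; Vt, Wt are the working blocks after the
   orthogonalization, and Vq, Hq, Wq, Fq the values before rescaling. *)
Definition btl_step (j : 'I_m.+1) (X Y : 'M[R]_(n, s)) V W H F : Prop :=
  exists (Vt Wt Vq Wq : 'M[R]_(n, s)) (Hq Fq P Q : 'M[R]_s) (d : 'rV[R]_s),
    [/\ orthogonalize V W j X (H ^~ j) Vt /\ orthogonalize W V j Y (F ^~ j) Wt,
        thin_qr Vt Vq Hq /\ thin_qr Wt Wq Fq,
        svd (Wq^T *m Vq) P d Q /\ diag_mx d \in unitmx,
        V j = Vq *m Q *m invmx (diag_sqrt d) /\
        W j = Wq *m P *m invmx (diag_sqrt d)
      & H j j = diag_sqrt d *m Q^T *m Hq /\ F j j = diag_sqrt d *m P^T *m Fq].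

Definition btl_rhs_V (A : 'M[R]_n) (B : 'M[R]_(n, p)) (sigma : 'I_m.+1 -> R)
    (Rt : 'I_m.+1 -> 'M[R]_(p, s)) (j : 'I_m.+1) : 'M[R]_(n, s) :=
  invmx ((sigma j)%:M - A) *m B *m Rt j.

Definition btl_rhs_W (A : 'M[R]_n) (C : 'M[R]_(p, n)) (mu : 'I_m.+1 -> R)
    (Lt : 'I_m.+1 -> 'M[R]_(p, s)) (j : 'I_m.+1) : 'M[R]_(n, s) :=
  (invmx ((mu j)%:M - A))^T *m C^T *m Lt j.

(* QR and SVD factorizations (and the initial factorizations) are not unique,
   so the algorithm is a relation: V, W, H, F are the final values of some
   breakdown-free run.  Values H i j, F i j with i > j are never set. *)
Definition btl (A : 'M[R]_n) (B : 'M[R]_(n, p)) (C : 'M[R]_(p, n))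
    (sigma mu : 'I_m.+1 -> R) (Rt Lt : 'I_m.+1 -> 'M[R]_(p, s))
    V W H F : Prop :=
  [/\ btl_rhs_V A B sigma Rt ord0 = V ord0 *m H ord0 ord0,
      btl_rhs_W A C mu Lt ord0 = W ord0 *m F ord0 ord0,
      (W ord0)^T *m V ord0 = 1%:M
    & forall j : 'I_m.+1, (0 < j)%N ->
        btl_step j (btl_rhs_V A B sigma Rt j) (btl_rhs_W A C mu Lt j) V W H F].

Definition bi_orthonormal V W : Prop :=
  forall i j, (W i)^T *m V j = if i == j then 1%:M else 0.

Definition block_upper H : 'M[R]_(\sum_(i < m.+1) s) :=
  \mxblock_(i, j) (if (i <= j)%N then H i j else 0).

End BlockTangentialLanczos.

Lemma sum_block_size k s : (k * s = \sum_(i < k) s)%N.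
Proof. by rewrite sum_nat_const card_ord. Qed.

(* Diag {a_0, .., a_{k-1}} (x) I_s; the cast identifies the size k * s of
   Kronecker products with the size \sum_(i < k) s of block matrices. *)
Definition diag_kron_id (R : realType) k s (a : 'I_k -> R) :
    'M[R]_(\sum_(i < k) s) :=
  castmx (sum_block_size k s, sum_block_size k s)
    (diag_mx (\row_i a i) *t (1%:M : 'M[R]_s)).

(* Main.v *)
Require Import Defs.
From mathcomp Require Import all_boot all_order all_algebra.
From mathcomp Require Import reals mxtens.

Import GRing.Theory Num.Theory.
Local Open Scope ring_scope.

(** One pass of the algorithm only rewrites the new block [X = T_j] without
    losing information: the successive updates subtract the [V_i H_ij] from
    [X] ([orthogonalize_decomp]), the QR factorization splits the remainder as
    a product, and the final rescaling inserts [Q D^-1/2 D^1/2 Q^T = 1] between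
    its two factors ([svd_rescaling_cancel]).  Hence [T_j] is the sum of the
    [V_i H_ij] over [i <= j], that is, the [j]-th block column of [V G]; this
    is [T = V G].

    The relation for [A V] then follows from the shape of [T] alone: a column
    block [T_j = (sigma_j I - A)^-1 B R_j] satisfies
    [A T_j = sigma_j T_j - B R_j], which reads [A T = T D - B R] for all blocks
    at once, and substituting [T = V G] and cancelling [G] on the right gives
    the claim ([shifted_solves_relation]).  The dual half is the same argument
    for [A^T], [C^T], [mu] and [L], the steps of the algorithm being symmetric
    in the two families. *)

(** Kronecker products index a position by quotient and remainder modulo [s],
    block matrices by enumerating the dependent pairs (block, offset); both
    are diagonal, and they agree because the [i]-th block of size [s] starts
    at position [i * s]. *)
Lemma diag_kron_idE (R : realType) (k s : nat) (a : 'I_k -> R) :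
  diag_kron_id s a = \mxdiag_(i < k) (a i)%:M.
Proof.
transitivity (diag_mx (\mxrow_(i < k) (const_mx (a i) : 'rV[R]_s))); last first.
  by rewrite diag_mxrow; apply/eq_mxdiagP => i; rewrite diag_const_mx.
apply/matrixP => x y; rewrite castmxE.
set x' := cast_ord _ x; set y' := cast_ord _ y.
have -> : x = cast_ord (sum_block_size k s) x' by exact: val_inj.
have -> : y = cast_ord (sum_block_size k s) y' by exact: val_inj.
clearbody x' y'; case: (mxtens_indexP x') => i u; case: (mxtens_indexP y') => j v.
have castE i0 (u0 : 'I_s) : cast_ord (sum_block_size k s) (mxtens_index (i0, u0))
    = tagnat.Rank (p_ := fun=> s) i0 u0.
  apply: ord_inj; rewrite tagnat.RankEsum /= (big_ord_narrow (ltnW (ltn_ord i0))).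
  by rewrite sum_nat_const card_ord.
rewrite tensmxE !castE !mxE tagnat.Rank1K.
have -> : (tagnat.Rank (p_ := fun=> s) i u == tagnat.Rank j v)
    = (i == j) && (u == v).
  rewrite -!castE (inj_eq (@cast_ord_inj _ _ _)).
  by rewrite (can_eq (@mxtens_indexK k s)).
by case: (i == j); case: (u == v); rewrite ?mulr1n ?mulr0n ?mulr1 ?mulr0 ?mul0r.
Qed.

Lemma orthogonalize_decomp (R : realType) (n s m : nat)
    (V W : 'I_m.+1 -> 'M[R]_(n, s)) (j : nat) (X Y : 'M[R]_(n, s))
    (h : 'I_m.+1 -> 'M[R]_s) :
  (j <= m.+1)%N -> orthogonalize V W j X h Y ->
  X = \sum_(i < m.+1 | (i < j)%N) V i *m h i + Y.
Proof.
move=> le_jm [Z [Z0 Zstep <-]]; rewrite -Z0.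
elim: j le_jm Zstep => [_ _|j IHj lt_jm Zstep].
  by rewrite big_pred0 ?add0r.
rewrite (IHj (ltnW lt_jm)); last by move=> i lt_ij; apply/Zstep/ltnW.
have [_ /= ->] := Zstep (Ordinal lt_jm) (ltnSn j).
rewrite [in RHS](bigD1 (Ordinal lt_jm)) //= [RHS]addrC addrA subrK addrC.
congr (_ + _); apply: eq_bigl => i.
by rewrite ltnS [in RHS]leq_eqVlt -val_eqE /=; case: ltngtP.
Qed.

(** An invertible singular value matrix has positive entries, hence an
    invertible square root, and [Q] is a square matrix with orthonormal columns;
    so the factors [Q D^-1/2] and [D^1/2 Q^T] moved between the basis and the
    coefficients cancel out. *)
Lemma svd_rescaling_cancel (R : realType) (n s : nat) (X : 'M[R]_(n, s))
    (U Q : 'M[R]_s) (d : 'rV[R]_s) :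
  Q^T *m Q = 1%:M -> (forall k, 0 <= d 0 k) -> diag_mx d \in unitmx ->
  (X *m Q *m invmx (diag_sqrt d)) *m (diag_sqrt d *m Q^T *m U) = X *m U.
Proof.
move=> QTQ d_ge0 d_unit.
have sqrtK : diag_sqrt d *m diag_sqrt d = diag_mx d.
  rewrite mulmx_diag; congr diag_mx; apply/rowP => k.
  by rewrite !mxE -expr2 sqr_sqrtr.
have sqrt_unit : diag_sqrt d \in unitmx.
  by move: d_unit; rewrite -sqrtK unitmx_mul => /andP[].
by rewrite -!mulmxA mulKmx // !mulmxA -(mulmxA X) (mulmx1C QTQ) mulmx1.
Qed.

Lemma btl_decomp {R : realType} {n p s m : nat}
    {A : 'M[R]_n} {B : 'M[R]_(n, p)} {C : 'M[R]_(p, n)}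
    {sigma mu : 'I_m.+1 -> R} {Rt Lt : 'I_m.+1 -> 'M[R]_(p, s)}
    {V W : 'I_m.+1 -> 'M[R]_(n, s)} {H F : 'I_m.+1 -> 'I_m.+1 -> 'M[R]_s}
    (j : 'I_m.+1) :
  btl A B C sigma mu Rt Lt V W H F ->
  btl_rhs_V A B sigma Rt j = \sum_(i < m.+1 | (i <= j)%N) V i *m H i j /\
  btl_rhs_W A C mu Lt j = \sum_(i < m.+1 | (i <= j)%N) W i *m F i j.
Proof.
case=> initV initW _ step.
(* The diagonal term is the block computed last, which orthogonalization
   leaves as its remainder. *)
have sum_leq (Z : 'I_m.+1 -> 'M[R]_(n, s)) :
    \sum_(i < m.+1 | (i <= j)%N) Z i = \sum_(i < m.+1 | (i < j)%N) Z i + Z j.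
  rewrite (bigD1 j) //= addrC; congr (_ + _); apply: eq_bigl => i.
  by rewrite [in RHS]ltn_neqAle andbC.
rewrite !sum_leq; case: (posnP j) => [j0 | /step].
  have -> : j = ord0 by exact: val_inj.
  by rewrite !big_pred0 ?add0r.
case=> Vt [Wt [Vq [Wq [Hq [Fq [P [Q [d]]]]]]]].
case=> [[orthV orthW] [[_ _ VtE] [_ _ WtE]] [[PTP QTQ d_ge0 _] d_unit]].
move=> [-> ->] [-> ->]; rewrite !svd_rescaling_cancel // -VtE -WtE.
by split; apply: orthogonalize_decomp (ltnW (ltn_ord j)) _; eassumption.
Qed.

Lemma mul_mxrow_block_upper (R : realType) (n s m : nat)
    (V : 'I_m.+1 -> 'M[R]_(n, s)) (H : 'I_m.+1 -> 'I_m.+1 -> 'M[R]_s) :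
  \mxrow_j V j *m block_upper H =
  \mxrow_(j < m.+1) (\sum_(i < m.+1 | (i <= j)%N) V i *m H i j).
Proof.
rewrite mul_mxrow_mxblock; apply: eq_mxrow => j.
rewrite [RHS]big_mkcond; apply: eq_bigr => i _.
by case: ifP => // _; rewrite mulmx0.
Qed.

(** Any factorization [T = V G], with [G] invertible, of the solutions [T_j] of
    the shifted systems [(sigma_j I - M) T_j = X_j] turns
    [M T = T D - X] into a relation for [V]. *)
Lemma shifted_solves_relation (R : realType) (n s k : nat) (M : 'M[R]_n)
    (sigma : 'I_k -> R) (X : 'I_k -> 'M[R]_(n, s))
    (V : 'M[R]_(n, \sum_(i < k) s)) (G : 'M[R]_(\sum_(i < k) s)) :
  (forall i, (sigma i)%:M - M \in unitmx) -> G \in unitmx ->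
  \mxrow_(j < k) (invmx ((sigma j)%:M - M) *m X j) = V *m G ->
  M *m V = (V *m G *m diag_kron_id s sigma - \mxrow_j X j) *m invmx G.
Proof.
move=> shift_unit G_unit TE; apply: (canRL (mulmxK G_unit)).
rewrite -(mulmxA M) -TE mul_mxrow diag_kron_idE mul_mxrow_mxdiag -mxrowB.
apply: eq_mxrow => j; set T := _ *m X j.
have <- : ((sigma j)%:M - M) *m T = X j by rewrite mulKVmx.
by rewrite mulmxBl mul_scalar_mx mul_mx_scalar subKr.
Qed.

Theorem theorem3p1 (R : realType) (n p s m : nat) (le_sp : (s <= p)%N)
    (A : 'M[R]_n) (B : 'M[R]_(n, p)) (C : 'M[R]_(p, n))
    (sigma mu : 'I_m.+1 -> R)
    (sigmaA_unit : forall i, (sigma i)%:M - A \in unitmx)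
    (muA_unit : forall i, (mu i)%:M - A \in unitmx)
    (Rt Lt : 'I_m.+1 -> 'M[R]_(p, s))
    (V W : 'I_m.+1 -> 'M[R]_(n, s))
    (H F : 'I_m.+1 -> 'I_m.+1 -> 'M[R]_s)
    (btlVW : btl A B C sigma mu Rt Lt V W H F)
    (biorthVW : bi_orthonormal V W)
    (G_unit : block_upper H \in unitmx)
    (Q_unit : block_upper F \in unitmx) :
  let VV := \mxrow_(j < m.+1) V j in
  let WW := \mxrow_(j < m.+1) W j in
  let RR := \mxrow_(j < m.+1) Rt j in
  let LL := \mxrow_(j < m.+1) Lt j in
  let TT := \mxrow_(j < m.+1) (invmx ((sigma j)%:M - A) *m B *m Rt j) in
  let YY := \mxrow_(j < m.+1) ((invmx ((mu j)%:M - A))^T *m C^T *m Lt j) in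
  let G := block_upper H in
  let Q := block_upper F in
  let D1 := diag_kron_id s sigma in
  let D2 := diag_kron_id s mu in
  [/\ A *m VV = (VV *m G *m D1 - B *m RR) *m invmx G,
      A^T *m WW = (WW *m Q *m D2 - C^T *m LL) *m invmx Q,
      TT = VV *m G
    & YY = WW *m Q].
Proof.
move=> VV WW RR LL TT YY G Q D1 D2.
have TE : TT = VV *m G.
  rewrite mul_mxrow_block_upper; apply: eq_mxrow => j.
  by have [] := btl_decomp j btlVW.
have YE : YY = WW *m Q.
  rewrite mul_mxrow_block_upper; apply: eq_mxrow => j.
  by have [] := btl_decomp j btlVW.
have tr_shift j : ((mu j)%:M - A)^T = (mu j)%:M - A^T.
  by rewrite linearB /= tr_scalar_mx.
split=> //.
- rewrite [B *m RR]mul_mxrow; apply: shifted_solves_relation => //.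
  by rewrite -TE; apply: eq_mxrow => j; rewrite mulmxA.
- rewrite [C^T *m LL]mul_mxrow; apply: shifted_solves_relation => // [j|].
    by rewrite -tr_shift unitmx_tr.
  by rewrite -YE; apply: eq_mxrow => j; rewrite -tr_shift -trmx_inv mulmxA.
Qed.
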